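(* For $0<H<1$, we have $$\max_{t\in[0,1]}x^H(t)=\frac{1}{3(1-2^{-H})}.$$ Moreover, $t=\frac13$ and $t=\frac23$ are the unique points in $[0,1]$ at which the function $x^H$ attains its maximum.
   Context: Faber--Schauder functions: for $t\in\mathbb R$, $e_{0,0}(t):=(\min\{t,1-t\})^+$ and $e_{m,k}(t):=2^{-m/2}e_{0,0}(2^mt-k)$ for $m\ge 1$, $k\in\mathbb Z$. The Takagi--Landsberg function with Hurst parameter $H>0$ is $$x^H(t):=\sum_{m=0}^\infty 2^{m(1/2-H)}\sum_{k=0}^{2^m-1}e_{m,k}(t),\qquad 0\le t\le 1.$$ *)

(* Defs.v *)
From HB Require Import structures.
From mathcomp Require Import all_boot all_order all_algebra.
From mathcomp Require Import all_classical all_reals all_analysis.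
From mathcomp Require Import lra.

Set Implicit Arguments.
Unset Strict Implicit.
Unset Printing Implicit Defensive.

Import Order.TTheory GRing.Theory Num.Theory.
Import numFieldNormedType.Exports.

Local Open Scope classical_set_scope.
Local Open Scope ring_scope.

Section FaberSchauder.
Context {R : realType}.
Implicit Types (t s H : R) (m n : nat) (k : int).

Definition tent t : R := Num.max (Num.min t (1 - t)) 0.

(* The function e_{m,k}. For m = k = 0 the formula gives back e_{0,0} = tent
   (faber_schauder00). *)
Definition faber_schauder m k t : R :=
  2 `^ (- (m%:R / 2)) * tent (2 ^+ m * t - k%:~R).

Definition takagi_term H t m : R :=
  2 `^ (m%:R * (1 / 2 - H)) * \sum_(0 <= k < 2 ^ m) faber_schauder m k%:Z t.

(* The limit of the partial sums; it exists when 0 < H (is_cvg_takagi). *)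
Definition takagi_landsberg H t : R := limn (series (takagi_term H t)).

Definition is_max (A : set R) c : Prop := A c /\ ubound A c.

Lemma faber_schauder00 t : faber_schauder 0 0 t = tent t.
Proof. by rewrite /faber_schauder mul0r !oppr0 powRr0 expr0 !mul1r addr0. Qed.

Lemma tent_ge0 t : 0 <= tent t.
Proof. by rewrite /tent le_max lexx orbT. Qed.

Lemma tent_eq0 t : t <= 0 \/ 1 <= t -> tent t = 0.
Proof.
move=> h; apply/max_idPr; rewrite ge_min.
by case: h => h; apply/orP; [left | right]; rewrite // subr_le0.
Qed.

Lemma tent_le1 t : tent t <= 1.
Proof.
rewrite /tent ge_max ler01 andbT ge_min.
by have [//|/ltW h] := leP t 1; rewrite lerBlDr lerDl (le_trans ler01 h).
Qed.

Lemma sum_tent_le1 n s : \sum_(0 <= k < n) tent (s - k%:Z%:~R) <= 1.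
Proof.
elim: n => [|n IHn]; first by rewrite big_geq // ler01.
rewrite big_nat_recr //=; have [sn|/ltW ns] := leP s n%:R.
  by rewrite [X in _ + X]tent_eq0 ?addr0 //; left; rewrite subr_le0.
rewrite big_nat_cond big1 ?add0r ?tent_le1// => k /andP[/andP[_ kn] _].
apply: tent_eq0; right; rewrite lerBrDr -pmulrn.
by rewrite (le_trans _ ns)// nat1r ler_nat.
Qed.

Lemma takagi_term_ge0 H t m : 0 <= takagi_term H t m.
Proof.
rewrite mulr_ge0 ?powR_ge0// sumr_ge0// => k _.
by rewrite mulr_ge0 ?powR_ge0 ?tent_ge0.
Qed.

Lemma takagi_term_le H t m : takagi_term H t m <= geometric 1 (2 `^ (- H)) m.
Proof.
rewrite /takagi_term /faber_schauder -big_distrr /= mulrA -powRD; last first.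
  by rewrite pnatr_eq0 implybT.
rewrite (_ : _ + _ = - H * m%:R); last by lra.
rewrite powRrM powR_mulrn ?powR_ge0// mul1r ler_piMr ?exprn_ge0 ?powR_ge0//.
exact: sum_tent_le1.
Qed.

Lemma is_cvg_takagi H t : 0 < H -> cvgn (series (takagi_term H t)).
Proof.
move=> H0; apply: (@series_le_cvg _ _ (geometric 1 (2 `^ (- H)))).
- exact: takagi_term_ge0.
- by move=> m; exact: le_trans (takagi_term_ge0 H t m) (takagi_term_le H t m).
- exact: takagi_term_le.
- apply: is_cvg_geometric_series; rewrite ger0_norm ?powR_ge0//.
  rewrite powRN invf_lt1 ?powR_gt0//.
  have := gt0_ltr_powR H0 (_ : 1 \in Num.nneg) (_ : 2 \in Num.nneg) (ltr1n R 2).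
  by rewrite powR1 !nnegrE ler01 ler0n; apply.
Qed.

End FaberSchauder.

(* Main.v *)
Require Import Defs.
From mathcomp Require Import all_boot all_order all_algebra.
From mathcomp Require Import all_classical all_reals all_analysis.
From mathcomp Require Import ring lra.

Import Order.TTheory GRing.Theory Num.Theory.
Import numFieldNormedType.Exports.
Local Open Scope classical_set_scope.
Local Open Scope ring_scope.

(** Put [a = 2^-H], so [1/2 < a < 1], and let [T = 2 tent] be the tent map,
    whose fixed point in (0, 1] is 2/3. On [0, 1] the function [x^H] is
    [t |-> (1/2) \sum_m a^m T^m (T t)]. If [d_m] is the deviation of
    [T^m (T t)] from 2/3, then [d_m > 0] forces [d_(m+1) = - 2 d_m], so that
    [d_m + a d_(m+1) = (1 - 2 a) d_m < 0]. The series [\sum_m a^m d_m] thus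
    splits into single terms with [d_m <= 0] and pairs with negative sum; it is
    nonpositive, and vanishes only if [T t = 2/3], i.e. [t] is 1/3 or 2/3. *)

Section TentMap.
Context {R : realType}.
Implicit Types (t s u a : R) (m n : nat).

Definition tent_map t : R := 2 * tent t.

Lemma tent_sym t : tent (1 - t) = tent t.
Proof. by rewrite /tent subKr minC. Qed.

Lemma tent_mapl t : 0 <= t <= 1 / 2 -> tent_map t = 2 * t.
Proof.
move=> /andP[t0 t2]; rewrite /tent_map /tent min_l; last by lra.
by rewrite max_l.
Qed.

Lemma tent_mapr t : 1 / 2 <= t <= 1 -> tent_map t = 2 - 2 * t.
Proof.
move=> /andP[t2 t1]; rewrite /tent_map /tent min_r; last by lra.
rewrite max_l; lra.
Qed.

Lemma tent_map_itv t : 0 <= t <= 1 -> 0 <= tent_map t <= 1.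
Proof.
move=> t01; have [t2|t2] := leP t (1 / 2).
  by rewrite tent_mapl; lra.
by rewrite tent_mapr; lra.
Qed.

Lemma tent_map_two_thirds : tent_map (2 / 3) = 2 / 3.
Proof. by rewrite tent_mapr; lra. Qed.

Lemma tent_map_eq_two_thirds t : 0 <= t <= 1 ->
  (tent_map t == 2 / 3) = (t == 1 / 3) || (t == 2 / 3).
Proof.
move=> t01; have [t2|t2] := leP t (1 / 2).
  rewrite tent_mapl; last by lra.
  by apply/eqP/orP => [h|[]/eqP h]; [left; apply/eqP| |]; lra.
rewrite tent_mapr; last by lra.
by apply/eqP/orP => [h|[]/eqP h]; [right; apply/eqP| |]; lra.
Qed.

(** Index reversal combined with [tent_sym]; it undoes the reflection that [tent_map] performs on
    [1/2, 1]. *)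
Lemma sum_tent_rev n u :
  \sum_(0 <= k < n) tent (n%:R - u - k%:R) = \sum_(0 <= k < n) tent (u - k%:R).
Proof.
rewrite big_nat_rev /= add0n; apply: eq_big_nat => k /andP[_ kn].
by rewrite -tent_sym natrB//; congr tent; rewrite -natr1; ring.
Qed.

(** By induction on [m]: the first half of the tents of level [m.+1] lives on [0, 1/2], the second
    half on [1/2, 1], and on either side the surviving half is the sum of level [m] at
    [tent_map t]. *)
Lemma sum_tent_iter m t : 0 <= t <= 1 ->
  \sum_(0 <= k < 2 ^ m) tent (2 ^+ m * t - k%:R) = tent (iter m tent_map t).
Proof.
elim: m t => [|m IHm] t t01.
  by rewrite expn0 big_nat1 expr0 mul1r subr0.
rewrite iterSr -IHm ?tent_map_itv//.
rewrite (@big_cat_nat _ _ _ (2 ^ m)) ?leq_exp2l//=.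
have m0 : 0 <= 2 ^+ m :> R by rewrite exprn_ge0.
have [t2|t2] := leP t (1 / 2).
  rewrite [X in _ + X]big_nat_cond [X in _ + X]big1 ?addr0 => [|k]; last first.
    rewrite andbT => /andP[mk _]; apply: tent_eq0; left.
    by move: mk; rewrite -(ler_nat R) natrX exprS => mk; nra.
  rewrite tent_mapl; last by lra.
  by apply: eq_bigr => k _; rewrite exprSr mulrA.
rewrite [X in X + _]big_nat_cond [X in X + _]big1 ?add0r => [|k]; last first.
  rewrite andbT => /andP[_ km]; apply: tent_eq0; right.
  by move: km; rewrite -(ler_nat R) natrX -natr1 exprS => km; nra.
rewrite -{1}(add0n (2 ^ m)%N) big_addn expnS mul2n -addnn addnK.
rewrite tent_mapr; last by lra.
rewrite -sum_tent_rev; apply: eq_bigr => k _; congr tent.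
by rewrite natrD natrX exprS; ring.
Qed.

(* The summand [a ^+ n] absorbs a last term [d_(n-1) > 0] that is left without
   its successor. *)
Lemma sum_tent_map_dev_le a n s : 1 / 2 < a < 1 -> 0 <= s <= 1 ->
  \sum_(m < n) a ^+ m * (iter m tent_map s - 2 / 3) <=
    a ^+ n - (2 * a - 1) * `|s - 2 / 3|.
Proof.
(* Strong induction, for all [s] at once, because a pair uses up two terms. *)
move=> a12; elim/ltn_ind: n s => -[|n] IHn s s01.
  rewrite big_ord0 expr0.
  by have [h|h] := ger0P (s - 2 / 3); nra.
have step k r : \sum_(m < k.+1) a ^+ m * (iter m tent_map r - 2 / 3) =
    r - 2 / 3 +
    a * \sum_(m < k) a ^+ m * (iter m tent_map (tent_map r) - 2 / 3).
  rewrite big_ord_recl expr0 mul1r /=; congr (_ + _).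
  rewrite big_distrr /=; apply: eq_bigr => i _.
  by rewrite -iterS iterSr exprS mulrA.
(* A nonpositive first deviation is split off alone: it equals -|s - 2/3|, which suffices since 2a -
   1 <= 1. *)
have [s23|s23] := leP s (2 / 3).
  have := IHn n (leqnn _) _ (tent_map_itv _ s01); rewrite step exprS.
  set S := \sum_(_ < _) _ => hS.
  have {}hS : S <= a ^+ n.
    by apply: (le_trans hS); rewrite gerBl mulr_ge0//; lra.
  by rewrite ler0_norm; nra.
rewrite gtr0_norm ?subr_gt0// step.
(* The first two terms add up to (1 - 2a)(s - 2/3), exactly the amount subtracted in the bound. A
   first term without partner fits because 2a(s - 2/3) <= a. *)
case: n IHn => [|n] IHn; first by rewrite big_ord0 expr1; nra.
have Ts : tent_map s = 2 - 2 * s by rewrite tent_mapr; lra.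
have := IHn n (leqW (leqnn _)) _ (tent_map_itv _ (tent_map_itv _ s01)).
rewrite step [in X in _ + a * (X + _)]Ts !exprS.
set S := \sum_(_ < _) _ => hS.
have {}hS : S <= a ^+ n.
  by apply: (le_trans hS); rewrite gerBl mulr_ge0//; lra.
have : a * (a * S) <= a * (a * a ^+ n) by rewrite !ler_pM2l; lra.
by nra.
Qed.

End TentMap.

Section TakagiMax.
Context {R : realType}.
Variable H : R.
Hypotheses (H_gt0 : 0 < H) (H_lt1 : H < 1).
Implicit Types (t : R) (m n : nat).

Let a : R := 2 `^ (- H).
Let M : R := 1 / (3 * (1 - a)).

(** The lower bound is 2a = 2^(1 - H) > 1, where H < 1 enters; the upper bound comes from H > 0. *)
Lemma powR2N_itv : 1 / 2 < a < 1.
Proof.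
have pow_gt1 (r : R) : 0 < r -> 1 < 2 `^ r.
  move=> r0; have := @gt0_ltr_powR R r r0 1 2.
  by rewrite powR1 !nnegrE ler01 ler0n ltr1n; apply.
apply/andP; split; last by rewrite /a powRN invf_lt1 ?powR_gt0 ?pow_gt1.
rewrite /a (_ : - H = (1 - H) - 1); last by lra.
rewrite powRB ?pnatr_eq0 ?implybT// powRr1// ltr_pM2r ?invr_gt0//.
by rewrite pow_gt1 ?subr_gt0.
Qed.

Lemma takagi_termE t m : 0 <= t <= 1 ->
  takagi_term H t m = a ^+ m * (iter m tent_map (tent_map t) / 2).
Proof.
move=> t01; rewrite /takagi_term /faber_schauder -big_distrr /= mulrA.
rewrite -powRD; last by rewrite pnatr_eq0 implybT.
rewrite (_ : _ + _ = - H * m%:R); last by lra.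
rewrite powRrM powR_mulrn ?powR_ge0// sum_tent_iter//.
by rewrite -iterSr iterS /tent_map mulrAC divff ?mul1r// pnatr_eq0.
Qed.

(** This is the series of [x^H] along the constant orbit 2/3, halved to 1/3. *)
Lemma cvg_geometric_third : series (geometric (1 / 3) a) @ \oo --> M.
Proof.
have a12 := powR2N_itv; rewrite /M invfM mulrA.
by apply: cvg_geometric_series; rewrite ger0_norm; lra.
Qed.

(** In the limit the correction a^n / 2 disappears while the multiple of |T t - 2/3| stays; this
    explicit gap yields both the maximum and its uniqueness. *)
Lemma takagi_landsberg_le t : 0 <= t <= 1 ->
  takagi_landsberg H t <= M - (2 * a - 1) / 2 * `|tent_map t - 2 / 3|.
Proof.
move=> t01; have a12 := powR2N_itv; set c := _ * `|_|.
have cvgB : series (geometric (1 / 3) a) n + (a ^+ n / 2 - c)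
    @[n --> \oo] --> M + (0 / 2 - c).
  apply: cvgD; first exact: cvg_geometric_third.
  apply: cvgB; last exact: cvg_cst.
  by apply: cvgMr_tmp; apply: cvg_expr; rewrite ger0_norm; lra.
rewrite mul0r add0r in cvgB; rewrite -(cvg_lim _ cvgB)//.
apply: ler_lim; [exact: is_cvg_takagi|by apply/cvg_ex; exists (M - c)|].
apply: nearW => n.
have := sum_tent_map_dev_le a n _ a12 (tent_map_itv _ t01).
set S := \sum_(_ < _) _ => hS.
suff -> : series (takagi_term H t) n = series (geometric (1 / 3) a) n + S / 2.
  by rewrite lerD2l /c; lra.
rewrite /series /= !big_mkord big_distrl -big_split /=.
by apply: eq_bigr => m _; rewrite takagi_termE//; lra.
Qed.

Lemma takagi_landsberg_max t : 0 <= t <= 1 -> tent_map t = 2 / 3 ->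
  takagi_landsberg H t = M.
Proof.
move=> t01 Tt; apply: cvg_lim => //.
rewrite (_ : takagi_term H t = geometric (1 / 3) a).
  exact: cvg_geometric_third.
apply/funext => m; rewrite takagi_termE// Tt iter_fix ?tent_map_two_thirds//=.
by lra.
Qed.

Lemma takagi_landsberg_le_max t : 0 <= t <= 1 -> takagi_landsberg H t <= M.
Proof.
move=> t01; apply: (le_trans (takagi_landsberg_le t t01)).
by have a12 := powR2N_itv; rewrite gerBl mulr_ge0//; lra.
Qed.

Lemma takagi_landsberg_eq_max t : 0 <= t <= 1 ->
  takagi_landsberg H t = M <-> t = 1 / 3 \/ t = 2 / 3.
Proof.
move=> t01; have TtE := tent_map_eq_two_thirds t t01; split => [xM|tE].
  have /orP[/eqP ->|/eqP ->] : (t == 1 / 3) || (t == 2 / 3); [|by left|by right].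
  rewrite -TtE -subr_eq0 -normr_le0.
  (* At the value [M] the gap cannot be positive, and its factor 2a - 1 is. *)
  by have := takagi_landsberg_le t t01; have := powR2N_itv; rewrite xM; nra.
apply: takagi_landsberg_max => //; apply/eqP; rewrite TtE.
by case: tE => ->; rewrite eqxx ?orbT.
Qed.

End TakagiMax.

Theorem theorem2p5 (R : realType) (H : R) (H_gt0 : 0 < H) (H_lt1 : H < 1) :
  let x := takagi_landsberg H in
  is_max (x @` `[0, 1]) (1 / (3 * (1 - 2 `^ (- H)))) /\
  [set t | t \in `[0, 1] /\ is_max (x @` `[0, 1]) (x t)] = [set 1 / 3; 2 / 3].
Proof.
move=> x; set M := 1 / _.
have xM (t : R) : 0 <= t <= 1 -> x t = M <-> t = 1 / 3 \/ t = 2 / 3.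
  exact: takagi_landsberg_eq_max.
have maxM : is_max (x @` `[0, 1]) M.
  split; last first.
    by move=> _ [t /= t01 <-]; apply: takagi_landsberg_le_max.
  exists (1 / 3); first by rewrite /= in_itv /=; lra.
  by apply/xM; [lra|left].
split=> //; apply/seteqP; split=> t /=.
  rewrite in_itv /= => -[t01 [_ xub]]; apply/xM => //.
  (* Two maxima of the same set bound each other. *)
  have [Mx ub] := maxM; apply/eqP; rewrite eq_le xub// andbT.
  by apply: ub; exists t => //=; rewrite in_itv.
move=> tE; have t01 : 0 <= t <= 1 by case: tE => ->; lra.
by rewrite in_itv; split=> //; move/(xM _ t01): tE => ->.
Qed.
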